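(* Let $d\geq 1$, $\delta>0$, and define $V_\delta:\mathbb{Z}^d\to\mathbb{R}$ by $V_\delta(n)=\delta$ if $\sum_{j=1}^d n_j$ is even and $V_\delta(n)=-\delta$ otherwise. Then $$\sigma(\Delta+V_\delta)\cap(-\delta,\delta)=\emptyset.$$
   Context: The discrete Laplacian on $\ell^2(\mathbb{Z}^d)$ is $\Delta u(n)=\sum_{j=1}^{d}\big(u(n-b_j)+u(n+b_j)\big)$, with $b_1,\dots,b_d$ the standard basis of $\mathbb{Z}^d$; $V_\delta$ acts on $\ell^2(\mathbb{Z}^d)$ by multiplication, and $\sigma$ denotes the spectrum. *)

(* Defs.v *)
From HB Require Import structures.
From mathcomp Require Import all_boot all_order all_algebra.
From mathcomp Require Import complex.
From mathcomp Require Import all_classical all_reals all_analysis.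
Set Implicit Arguments.
Unset Strict Implicit.
Unset Printing Implicit Defensive.
Import Order.TTheory GRing.Theory Num.Theory.
Local Open Scope classical_set_scope.
Local Open Scope ring_scope.
Local Open Scope complex_scope.

(* The Hilbert space l^2(T) is the set [l2 T] of square-summable functions
   T -> R[i].  Operators on it are functions on all of T -> R[i], of which only
   the values on [l2 T] matter. *)

Section L2.
Context {R : realType} {T : choiceType}.
Implicit Types (u v : T -> R[i]) (A S : (T -> R[i]) -> (T -> R[i])) (z : R[i]).

Definition l2_sqr_norm u : \bar R :=
  \esum_(n in [set: T]) (ComplexField.Normc.normc (u n) ^+ 2)%:E.

Definition l2 : set (T -> R[i]) := [set u | (l2_sqr_norm u < +oo)%E].

Definition l2_norm u : R := Num.sqrt (fine (l2_sqr_norm u)).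

Definition bounded_linear_on_l2 S : Prop :=
  [/\ forall u, l2 u -> l2 (S u),
      forall z u v, l2 u -> l2 v ->
        S (fun n => z * u n + v n) = (fun n => z * S u n + S v n) &
      exists M : R, forall u, l2 u -> l2_norm (S u) <= M * l2_norm u].

(* [z] is in the resolvent set when A - z has a bounded two-sided inverse
   on l^2; used only for operators A that map l^2 to itself. *)
Definition resolvent_set A : set R[i] :=
  [set z | exists S, bounded_linear_on_l2 S /\
     forall u, l2 u ->
       S (fun n => A u n - z * u n) = u /\
       (fun n => A (S u) n - z * S u n) = u].

Definition spectrum A : set R[i] := ~` resolvent_set A.

End L2.

Section Schrodinger.
Context {R : realType} {d : nat}.

(* Z^d is 'rV[int]_d, with standard basis vectors delta_mx 0 j. *)
Definition laplacian (u : 'rV[int]_d -> R[i]) : 'rV[int]_d -> R[i] :=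
  fun n => \sum_(j < d) (u (n - delta_mx 0 j) + u (n + delta_mx 0 j)).

Definition checkerboard (delta : R) (n : 'rV[int]_d) : R :=
  if (2 %| \sum_(j < d) n 0 j)%Z then delta else - delta.

Definition schrodinger (V : 'rV[int]_d -> R) (u : 'rV[int]_d -> R[i]) :
    'rV[int]_d -> R[i] :=
  fun n => laplacian u n + (V n)%:C * u n.

End Schrodinger.

(* Main.v *)
Require Import Defs.
From mathcomp Require Import all_boot all_order all_algebra.
From mathcomp Require Import complex.
From mathcomp Require Import all_classical all_reals all_analysis.
From mathcomp Require Import finmap zify ring lra.
Set Implicit Arguments.
Unset Strict Implicit.
Unset Printing Implicit Defensive.
Import Order.TTheory GRing.Theory Num.Theory.
Import numFieldNormedType.Exports.
Local Open Scope classical_set_scope.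
Local Open Scope ring_scope.
Local Open Scope complex_scope.

(** Let J be multiplication by the parity sign, so that V = delta J and
    A = L + V with L the Laplacian.  Every hop changes the parity, hence
    L J = - J L; as L and J are symmetric, <L f, J f> = 0 and
    |A f|^2 = |L f|^2 + delta^2 |f|^2 >= delta^2 |f|^2.  For |x| < delta the
    operator P = (A - x)(A + x) = A^2 - x^2 is therefore bounded with
    <P f, f> >= (delta^2 - x^2) |f|^2, so 1 - P / K is a strict contraction of
    l^2 for K large, P is inverted by a Neumann series, and
    (A - x)^-1 = (A + x) P^-1.  All operators involved are local, so the
    series can be summed pointwise; their coefficients are real, so everything
    is done on real-valued functions and transferred to R[i] through real and
    imaginary parts. *)

(** * Summable real functions and their signed sums *)

Section Sums.
Context {R : realType} {T : choiceType}.
Implicit Types (f g h : T -> R) (a M : R).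

Definition summ h := summable [set: T] (EFin \o h).

(* [|h| + h] and [|h|] are nonnegative, as [esum] requires; the value is
   meaningful only when [summ h]. *)
Definition rsum h : R :=
  fine (\esum_(n in [set: T]) (`|h n| + h n)%:E)
  - fine (\esum_(n in [set: T]) `|h n|%:E).

Lemma summE h : summ h <-> (\esum_(n in [set: T]) `|h n|%:E < +oo)%E.
Proof. by []. Qed.

(** One inequality is enough: for [a > 0] the converse comes from scaling back by [a^-1]. *)
Lemma esumZl_le a h : 0 <= a -> (forall n, 0 <= h n) ->
  (\esum_(n in [set: T]) (a * h n)%:E <= a%:E * \esum_(n in [set: T]) (h n)%:E)%E.
Proof.
move=> a0 h0; apply: ge_ereal_sup => _ [X [finX XT] <-].
under eq_fsbigr do rewrite EFinM.
rewrite -ge0_mule_fsumr; last by move=> n; rewrite lee_fin.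
by apply: lee_wpmul2l; rewrite ?lee_fin//; apply: esum_ge; exists X.
Qed.

Lemma le_summ g h : (forall n, `|g n| <= `|h n|) -> summ h -> summ g.
Proof.
by move=> gh; apply: le_lt_trans; apply: le_esum => n _; rewrite lee_fin.
Qed.

Lemma summ_abs h : summ h -> summ (fun n => `|h n|).
Proof. by apply: le_summ => n; rewrite normr_id. Qed.

Lemma summD g h : summ g -> summ h -> summ (fun n => g n + h n).
Proof.
move=> sg sh; have := summableD sg sh; apply: le_lt_trans.
by apply: le_esum => n _ /=.
Qed.

Lemma summZ a h : summ h -> summ (fun n => a * h n).
Proof.
move=> sh; apply: (@le_lt_trans _ _ (`|a|%:E * \esum_(n in [set: T]) `|h n|%:E)%E).
  rewrite -[leLHS]/(\esum_(n in [set: T]) `|a * h n|%:E)%E.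
  under eq_esum do rewrite normrM.
  by apply: esumZl_le.
move/summE : sh; have: (0 <= \esum_(n in [set: T]) `|h n|%:E)%E.
  by apply: esum_ge0 => n _; rewrite lee_fin.
by case: (\esum_(_ in _) _)%E => // r _ _; rewrite -EFinM ltry.
Qed.

Lemma summ_bij (s : T -> T) h : set_bij setT setT s -> summ h -> summ (h \o s).
Proof. by move=> bs; rewrite /summ /summable (reindex_esum setT setT s). Qed.

Lemma summ_ge0E h : (forall n, 0 <= h n) ->
  summ h <-> (\esum_(n in [set: T]) (h n)%:E < +oo)%E.
Proof.
move=> h0; rewrite summE; suff -> : (fun n => `|h n|%:E) = (fun n => (h n)%:E) by [].
by apply/funext => n; rewrite ger0_norm.
Qed.

Lemma esum_fin h : (forall n, 0 <= h n) -> summ h ->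
  \esum_(n in [set: T]) (h n)%:E \is a fin_num.
Proof.
move=> h0 /(summ_ge0E h0) sh; rewrite ge0_fin_numE//.
by apply: esum_ge0 => n _; rewrite lee_fin.
Qed.

Lemma fine_esumD g h : (forall n, 0 <= g n) -> (forall n, 0 <= h n) ->
  summ g -> summ h ->
  fine (\esum_(n in [set: T]) (g n + h n)%:E) =
  fine (\esum_(n in [set: T]) (g n)%:E) + fine (\esum_(n in [set: T]) (h n)%:E).
Proof.
move=> g0 h0 sg sh; rewrite -fineD ?esum_fin// -esumD//;
  by move=> n _; rewrite lee_fin.
Qed.

Lemma rsum_ge0E h : (forall n, 0 <= h n) -> summ h ->
  rsum h = fine (\esum_(n in [set: T]) (h n)%:E).
Proof.
move=> h0 sh; rewrite /rsum; under eq_esum do rewrite ger0_norm//.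
under [X in _ - fine X]eq_esum do rewrite ger0_norm//.
by rewrite fine_esumD// addrK.
Qed.

Lemma rsum_ge0 h : (forall n, 0 <= h n) -> summ h -> 0 <= rsum h.
Proof.
move=> h0 sh; rewrite rsum_ge0E//; apply/fine_ge0/esum_ge0 => n _.
by rewrite lee_fin.
Qed.

Let normD_ge0 h n : 0 <= `|h n| + h n.
Proof. by rewrite -lerBlDr sub0r -normrN ler_norm. Qed.

(** Extended sums are additive only on nonnegative functions, so the claim is rearranged into an
    identity between sums of such functions. *)
Lemma rsumD g h : summ g -> summ h ->
  rsum (fun n => g n + h n) = rsum g + rsum h.
Proof.
move=> sg sh.
have sgh := summD sg sh.
have ag := summ_abs sg; have ah := summ_abs sh; have agh := summ_abs sgh.
have pg := normD_ge0 g; have ph := normD_ge0 h.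
have pgh n : 0 <= `|g n + h n| + (g n + h n).
  exact: (normD_ge0 (fun n => g n + h n)).
have sg1 := summD ag sg; have sh1 := summD ah sh.
have sgh1 := summD agh sgh.
(* Each side collects nonnegative summands only; splitting both and moving the absolute values
   across gives additivity of [rsum]. *)
have : fine (\esum_(n in [set: T]) ((`|g n + h n| + (g n + h n)) + (`|g n| + `|h n|))%:E)
   = fine (\esum_(n in [set: T]) ((`|g n| + g n) + (`|h n| + h n) + `|g n + h n|)%:E).
  congr fine; apply: eq_esum => n _; congr EFin; ring.
rewrite (fine_esumD pgh _ sgh1 (summD ag ah)); last by move=> n; rewrite addr_ge0.
rewrite (fine_esumD _ _ ag ah)// (fine_esumD _ _ (summD sg1 sh1) agh)//; last first.
  by move=> n; rewrite addr_ge0.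
rewrite (fine_esumD pg ph sg1 sh1) /rsum; lra.
Qed.

Lemma rsumN h : summ h -> rsum (fun n => - h n) = - rsum h.
Proof.
move=> sh; apply/eqP; rewrite -addr_eq0 -rsumD//; last first.
  by have := summZ (-1) sh; under eq_fun do rewrite mulN1r.
rewrite [X in rsum X](_ : _ = (fun=> 0)); last by apply/funext => n; rewrite addNr.
rewrite rsum_ge0E//; last by rewrite /summ /summable esum1//= => n _; rewrite normr0.
by rewrite esum1.
Qed.

Let rsumZ_ge0 a h : 0 <= a -> summ h -> (forall n, 0 <= h n) ->
  rsum (fun n => a * h n) = a * rsum h.
Proof.
move=> a0 sh h0.
have le b k : 0 <= b -> summ k -> (forall n, 0 <= k n) ->
    rsum (fun n => b * k n) <= b * rsum k.
  move=> b0 sk k0; have bk0 n : 0 <= b * k n by rewrite mulr_ge0.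
  have sbk := summZ b sk.
  rewrite !rsum_ge0E// -lee_fin EFinM !fineK ?esum_fin//; exact: esumZl_le.
apply/eqP; rewrite eq_le le//=.
have [->|an0] := eqVneq a 0.
  rewrite mul0r; apply: rsum_ge0; last exact: summZ.
  by move=> n; rewrite mul0r.
have {an0}a0 : 0 < a by rewrite lt_neqAle eq_sym an0.
(* The upper bound applied to [a^-1] and [a * h] is the missing lower bound. *)
have : rsum (fun n => a^-1 * (a * h n)) <= a^-1 * rsum (fun n => a * h n).
  apply: le; first by rewrite invr_ge0 ltW.
    exact: summZ.
  by move=> n; rewrite mulr_ge0// ltW.
by under eq_fun do rewrite mulKf ?gt_eqF//; rewrite ler_pdivlMl.
Qed.

Lemma rsumZ a h : summ h -> rsum (fun n => a * h n) = a * rsum h.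
Proof.
wlog a0 : a / 0 <= a => [th sh|sh].
  have [a0|a0] := leP 0 a; first exact: th.
  have := th (- a); rewrite oppr_ge0 (ltW a0) => /(_ isT sh) e.
  rewrite -[RHS]opprK -mulNr -e -rsumN; last exact: summZ.
  by congr rsum; apply/funext => n; rewrite mulNr opprK.
have ah := summ_abs sh; have ch := summD ah sh.
(* Homogeneity is known for the nonnegative functions [|h| + h] and [|h|]; cancelling the second
   leaves [h]. *)
have := rsumZ_ge0 a0 ch (normD_ge0 h).
rewrite (rsumD ah sh) mulrDr -(rsumZ_ge0 a0 ah)//.
under eq_fun do rewrite mulrDr.
rewrite rsumD; [by move/addrI|exact: summZ|exact: summZ].
Qed.

Lemma ler_rsum g h : summ g -> summ h -> (forall n, g n <= h n) ->
  rsum g <= rsum h.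
Proof.
move=> sg sh gh; rewrite -subr_ge0 -mulN1r -rsumZ// -rsumD//; last exact: summZ.
apply: rsum_ge0; last by apply: summD => //; exact: summZ.
by move=> n; rewrite mulN1r subr_ge0.
Qed.

Lemma rsum_bij (s : T -> T) h : set_bij setT setT s -> rsum (h \o s) = rsum h.
Proof.
move=> bs; rewrite /rsum (reindex_esum setT setT s (fun n => (`|h n| + h n)%:E))//.
by rewrite (reindex_esum setT setT s (fun n => `|h n|%:E)).
Qed.

Lemma fsum_le_rsum (X : set T) h : finite_set X -> (forall n, 0 <= h n) ->
  summ h -> \sum_(n \in X) h n <= rsum h.
Proof.
move=> finX h0 sh; rewrite rsum_ge0E// -lee_fin fineK ?esum_fin//.
by apply: esum_ge; exists X => //; rewrite fsumEFin.
Qed.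

Lemma le_rsum h n : (forall n, 0 <= h n) -> summ h -> h n <= rsum h.
Proof.
by move=> h0 sh; have := fsum_le_rsum (finite_set1 n) h0 sh;
  rewrite fsbig_set1.
Qed.

(** The extended sum is the supremum of the finite partial sums, so a uniform bound on these yields
    finiteness and the bound at once. *)
Lemma rsum_le_fsum h M : (forall n, 0 <= h n) ->
  (forall X : set T, finite_set X -> \sum_(n \in X) h n <= M) ->
  summ h /\ rsum h <= M.
Proof.
move=> h0 hM.
have H : (\esum_(n in [set: T]) (h n)%:E <= M%:E)%E.
  by apply: ge_ereal_sup => _ [X [finX _] <-]; rewrite fsumEFin// lee_fin hM.
have sh : summ h by apply/summ_ge0E => //; rewrite (le_lt_trans H) ?ltry.
by split=> //; rewrite rsum_ge0E// -lee_fin fineK ?esum_fin.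
Qed.

End Sums.

(** * Real square-summable functions, their inner product, and bounded operators on them *)

Section RealL2.
Context {R : realType} {T : choiceType}.
Implicit Types (f g h : T -> R) (a b M : R) (B C : (T -> R) -> T -> R).

Definition sqsum f := summ (fun n => f n ^+ 2).

Definition dot f g : R := rsum (fun n => f n * g n).

(** Follows from [|f g| <= f^2 + g^2], obtained from [(f - g)^2 >= 0] and [(f + g)^2 >= 0]. *)
Lemma summM f g : sqsum f -> sqsum g -> summ (fun n => f n * g n).
Proof.
move=> sf sg; apply: (le_summ _ (summD sf sg)) => n.
rewrite [leRHS]ger0_norm ?addr_ge0 ?sqr_ge0// ler_norml.
have := sqr_ge0 (f n - g n); have := sqr_ge0 (f n + g n).
have := sqr_ge0 (f n); have := sqr_ge0 (g n); rewrite !expr2; lra.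
Qed.

Lemma sqsum_comb a f g : sqsum f -> sqsum g ->
  sqsum (fun n => a * f n + g n).
Proof.
move=> sf sg; apply: (le_summ _ (summD (summZ (2 * a ^+ 2) sf) (summZ 2 sg))) => n.
rewrite [leLHS]ger0_norm ?sqr_ge0//; apply: le_trans (ler_norm _).
(* This is [(a f + g)^2 <= 2 a^2 f^2 + 2 g^2], the difference being [(a f - g)^2]. *)
by have := sqr_ge0 (a * f n - g n); rewrite !expr2; lra.
Qed.

Lemma dotC f g : dot f g = dot g f.
Proof. by congr rsum; apply/funext => n; rewrite mulrC. Qed.

Lemma dot_combl a f g h : sqsum f -> sqsum g -> sqsum h ->
  dot (fun n => a * f n + g n) h = a * dot f h + dot g h.
Proof.
move=> sf sg sh; rewrite /dot -rsumZ; last exact: summM.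
rewrite -rsumD; [|by apply: summZ; exact: summM|exact: summM].
by congr rsum; apply/funext => n; ring.
Qed.

Lemma dot_combr a f g h : sqsum f -> sqsum g -> sqsum h ->
  dot h (fun n => a * f n + g n) = a * dot h f + dot h g.
Proof. by move=> *; rewrite dotC dot_combl// !(dotC _ h). Qed.

Lemma sqsumZ a f : sqsum f -> sqsum (fun n => a * f n).
Proof.
move=> sf; have := summZ (a ^+ 2) sf; rewrite /sqsum.
by under [X in _ -> summ X]eq_fun do rewrite exprMn.
Qed.

Lemma dotZl a f g : sqsum f -> sqsum g ->
  dot (fun n => a * f n) g = a * dot f g.
Proof.
move=> sf sg; rewrite /dot -rsumZ; last exact: summM.
by under eq_fun do rewrite -mulrA.
Qed.

Lemma summ_sq f : sqsum f -> summ (fun n => f n * f n).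
Proof. by move=> sf; exact: summM. Qed.

Lemma dot_ge0 f : sqsum f -> 0 <= dot f f.
Proof.
by move=> sf; apply: rsum_ge0 => [n|]; [rewrite -expr2 sqr_ge0|exact: summ_sq].
Qed.

Lemma sqr_le_dot f n : sqsum f -> f n ^+ 2 <= dot f f.
Proof.
move=> sf; rewrite expr2; apply: (@le_rsum _ _ (fun n => f n * f n)) => [k|].
  by rewrite -expr2 sqr_ge0.
exact: summ_sq.
Qed.

Lemma sqsum_sum (J : Type) (r : seq J) (F : J -> T -> R) :
  sqsum (fun=> 0) -> (forall i, sqsum (F i)) ->
  sqsum (fun n => \sum_(i <- r) F i n).
Proof.
move=> s0 sF; elim: r => [|i r IH].
  by under eq_fun do rewrite big_nil.
under eq_fun do rewrite big_cons -[X in X + _]mul1r.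
exact: sqsum_comb.
Qed.

Lemma dot_suml (J : Type) (r : seq J) (F : J -> T -> R) g :
  (forall i, sqsum (F i)) -> sqsum g ->
  dot (fun n => \sum_(i <- r) F i n) g = \sum_(i <- r) dot (F i) g.
Proof.
move=> sF sg.
have s0 : sqsum (fun=> 0).
  by have := sqsumZ 0 sg; under [X in sqsum X -> _]eq_fun do rewrite mul0r.
elim: r => [|i r IH].
  have -> : (fun n => \sum_(i <- [::]) F i n) = (fun n => 0 * g n).
    by apply/funext => n; rewrite big_nil mul0r.
  by rewrite big_nil dotZl// mul0r.
under [X in dot X _]eq_fun do rewrite big_cons -[X in X + _]mul1r.
by rewrite dot_combl ?big_cons ?IH ?mul1r//; exact: sqsum_sum.
Qed.

Lemma dot_sqrD a f g : sqsum f -> sqsum g ->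
  dot (fun n => a * f n + g n) (fun n => a * f n + g n) =
  a ^+ 2 * dot f f + 2 * a * dot f g + dot g g.
Proof.
move=> sf sg; rewrite dot_combl ?dot_combr//; last exact: sqsum_comb.
rewrite (dotC g f); ring.
Qed.

(** Fatou's lemma for counting measure: every finite partial sum of squares passes to the pointwise
    limit and keeps the bound [M]. *)
Lemma dot_fatou (v : nat -> T -> R) f M :
  (forall k, sqsum (v k) /\ dot (v k) (v k) <= M) ->
  (forall n, v k n @[k --> \oo] --> f n) -> sqsum f /\ dot f f <= M.
Proof.
move=> vM vf.
suff [s le] : summ (fun n => f n * f n) /\ dot f f <= M.
  by split=> //; rewrite /sqsum; under eq_fun do rewrite expr2.
apply: rsum_le_fsum => [n|X finX]; first by rewrite -expr2 sqr_ge0.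
rewrite fsbig_finite//=.
have cv : \sum_(n <- fset_set X) (v k n * v k n) @[k --> \oo] -->
    \sum_(n <- fset_set X) (f n * f n).
  by apply: cvg_big => [|n _]; [exact: add_continuous|exact: cvgM].
apply: (cvgr_to_le cv); apply: nearW => k; have [sv vk] := vM k.
apply: le_trans vk; rewrite -fsbig_finite//; apply: fsum_le_rsum (summ_sq sv) => //.
by move=> n; rewrite -expr2 sqr_ge0.
Qed.

(* Continuity for pointwise convergence holds for finite-range operators; it
   lets them commute with the pointwise sum of a Neumann series. *)
Record tame B : Prop := Tame {
  tame_lin : forall a f g,
    B (fun n => a * f n + g n) = (fun n => a * B f n + B g n) ;
  tame_cvg : forall (v : nat -> T -> R) f,
    (forall n, v k n @[k --> \oo] --> f n) ->
    forall n, B (v k) n @[k --> \oo] --> B f n ;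
  tame_bdd : exists2 M, 0 <= M &
    forall f, sqsum f -> sqsum (B f) /\ dot (B f) (B f) <= M * dot f f }.

Lemma tame_sqsum B f : tame B -> sqsum f -> sqsum (B f).
Proof. by move=> [_ _ [M _ BM]] /BM[]. Qed.

Lemma tame0 B : tame B -> B (fun=> 0) = (fun=> 0).
Proof.
move=> tB; have /(congr1 (fun f => f _)) := tame_lin tB 1 (fun=> 0) (fun=> 0).
move=> e; apply/funext => n; have := e n; under eq_fun do rewrite mulr0 addr0.
by move=> /eqP; rewrite mul1r eq_sym -subr_eq0 addrK => /eqP.
Qed.

Lemma tameZ B a f : tame B -> B (fun n => a * f n) = (fun n => a * B f n).
Proof.
move=> tB; have := tame_lin tB a f (fun=> 0); rewrite tame0//.
by under eq_fun do rewrite addr0; move=> ->; apply/funext => n; rewrite addr0.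
Qed.

Lemma tameD B f g : tame B ->
  B (fun n => f n + g n) = (fun n => B f n + B g n).
Proof.
move=> tB; have := tame_lin tB 1 f g.
by under eq_fun do rewrite mul1r; move=> ->; apply/funext => n; rewrite mul1r.
Qed.

Lemma tame_id : tame id.
Proof.
by split=> //; exists 1 => // f sf; rewrite mul1r.
Qed.

Lemma tame_zero : tame (fun _ _ => 0).
Proof.
split=> [a f g|v f _ n|]; first by apply/funext => n; rewrite mulr0 addr0.
  exact: cvg_cst.
exists 0 => // f sf; rewrite (_ : (fun=> 0) = (fun n => 0 * f n)).
  by split; [exact: sqsumZ|rewrite dotZl ?mul0r//; exact: sqsumZ].
by apply/funext => n; rewrite mul0r.
Qed.

Lemma tame_comb a B C : tame B -> tame C ->
  tame (fun f n => a * B f n + C f n).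
Proof.
move=> [Bl Bc [M M0 BM]] [Cl Cc [N N0 CN]]; split=> [b f g|v f vf n|].
- by rewrite Bl Cl; apply/funext => n; ring.
- by apply: cvgD; [apply: cvgM; [exact: cvg_cst|exact: Bc]|exact: Cc].
(* From [|a B f + C f|^2 <= 2 a^2 |B f|^2 + 2 |C f|^2], which is [|- a B f + C f|^2 >= 0]
   rearranged. *)
exists (2 * a ^+ 2 * M + 2 * N) => [|f sf].
  by rewrite addr_ge0// mulr_ge0// mulr_ge0// sqr_ge0.
have [sB leB] := BM _ sf; have [sC leC] := CN _ sf.
split; first exact: sqsum_comb.
have := dot_ge0 (sqsum_comb (- a) sB sC).
rewrite !dot_sqrD//.
have := ler_wpM2l (sqr_ge0 a) leB; lra.
Qed.

Lemma tame_comp B C : tame B -> tame C -> tame (B \o C).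
Proof.
move=> [Bl Bc [M M0 BM]] [Cl Cc [N N0 CN]]; split=> [b f g|v f vf n|].
- by rewrite /= Cl Bl.
- by apply: Bc => k; exact: Cc.
exists (M * N) => [|f sf]; first by rewrite mulr_ge0.
have [sC leC] := CN _ sf; have [sB leB] := BM _ sC; split=> //.
by rewrite (le_trans leB)// -mulrA ler_wpM2l.
Qed.

Lemma tame_sum (I : Type) (r : seq I) (B : I -> (T -> R) -> T -> R) :
  (forall i, tame (B i)) -> tame (fun f n => \sum_(i <- r) B i f n).
Proof.
move=> tB; elim: r => [|i r IH].
  by under eq_fun do under eq_fun do rewrite big_nil; exact: tame_zero.
under eq_fun do under eq_fun do rewrite big_cons -[X in X + _]mul1r.
exact: tame_comb.
Qed.

(** Permuting the index set preserves sums, so the operator is an isometry. *)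
Lemma tame_reindex (s : T -> T) : set_bij setT setT s ->
  tame (fun f n => f (s n)).
Proof.
move=> bs; split=> //.
exists 1 => // f sf; split; first exact: (summ_bij bs sf).
by rewrite mul1r /dot -(rsum_bij (fun n => f n * f n) bs).
Qed.

Lemma tame_mul (w : T -> R) a : (forall n, `|w n| <= a) ->
  tame (fun f n => w n * f n).
Proof.
move=> wa; split=> [b f g|v f vf n|]; first by apply/funext => n; ring.
  by apply: cvgM; [exact: cvg_cst|exact: vf].
have le f n : (w n * f n) ^+ 2 <= a ^+ 2 * f n ^+ 2.
  rewrite exprMn ler_wpM2r ?sqr_ge0// -real_normK ?num_real// ler_sqr ?nnegrE//.
  exact: le_trans (wa n).
have s f : sqsum f -> sqsum (fun n => w n * f n).
  move=> sf; apply: le_summ (summZ (a ^+ 2) sf) => n.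
  by rewrite ger0_norm ?sqr_ge0// (le_trans (le f n))// ler_norm.
exists (a ^+ 2) => [|f sf]; first exact: sqr_ge0.
split; first exact: s.
rewrite /dot -rsumZ; last exact: summ_sq.
apply: ler_rsum => [||n]; [exact/summ_sq/s|by apply: summZ; exact: summ_sq|].
by rewrite -!expr2.
Qed.

End RealL2.

(** * The Neumann series of a contraction, summed pointwise *)

Section Neumann.
Context {R : realType} {I : choiceType}.
Variables (T : (I -> R) -> I -> R) (q : R).
Hypotheses (tT : tame T) (q0 : 0 <= q) (q1 : q < 1).
Hypothesis contr : forall f, sqsum f -> dot (T f) (T f) <= q * dot f f.
Implicit Types (u v : I -> R) (B : (I -> R) -> I -> R).

(** For each [n] this is a limit of real numbers; its value is meaningful once the series converges,
    as it does for [sqsum u]. *)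
Definition neumann u n : R := lim (series (fun i => iter i T u n) @ \oo).

Lemma iter_contr i u : sqsum u ->
  sqsum (iter i T u) /\ dot (iter i T u) (iter i T u) <= q ^+ i * dot u u.
Proof.
move=> su; elim: i => [|i [sI leI]]; first by rewrite mul1r.
split; first exact: (tame_sqsum tT sI).
by rewrite iterS (le_trans (contr sI))// exprS -mulrA ler_wpM2l.
Qed.

(** A value of a function is at most its norm, so the terms are dominated by a geometric series. Its
    ratio is [Num.sqrt q] because [q] contracts squared norms. *)
Lemma cvg_neumann u n : sqsum u ->
  series (fun i => iter i T u n) k @[k --> \oo] --> neumann u n.
Proof.
move=> su; apply: normed_cvg.
apply: (@series_le_cvg _ _ (geometric (Num.sqrt (dot u u)) (Num.sqrt q))).
- by move=> i; exact: normr_ge0.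
- by move=> i /=; rewrite mulr_ge0// exprn_ge0.
- move=> i /=; have [sI leI] := iter_contr i su.
  rewrite -ler_sqr ?nnegrE ?mulr_ge0 ?exprn_ge0//.
  rewrite exprMn exprAC !sqr_sqrtr ?dot_ge0// real_normK ?num_real//.
  by rewrite mulrC (le_trans _ leI)// sqr_le_dot.
- apply: is_cvg_geometric_series; rewrite ger0_norm//.
  by rewrite -[ltRHS]sqrtr1 ltr_sqrt.
Qed.

Lemma series_iterS u k n : series (fun i => iter i T u n) k.+1 =
  u n + series (fun i => iter i T (T u) n) k.
Proof.
rewrite seriesEord/= big_ord_recl/=; congr (_ + _).
by rewrite seriesEord/=; apply: eq_bigr => i _; rewrite -iterSr.
Qed.

Lemma tame_series_iter B u k : tame B -> (forall f, B (T f) = T (B f)) ->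
  B (fun n => series (fun i => iter i T u n) k) =
  (fun n => series (fun i => iter i T (B u) n) k).
Proof.
move=> tB BT; elim: k u => [|k IH] u.
  under eq_fun do rewrite seriesEord/= big_ord0.
  by rewrite tame0//; apply/funext => n; rewrite seriesEord/= big_ord0.
under eq_fun do rewrite series_iterS.
by rewrite tameD// IH BT; apply/funext => n; rewrite series_iterS.
Qed.

(** [B] commutes with each partial sum, and [tame_cvg] carries this to the pointwise limit. *)
Lemma neumann_comm B u : tame B -> (forall f, B (T f) = T (B f)) ->
  sqsum u -> B (neumann u) = neumann (B u).
Proof.
move=> tB BT su; apply/funext => n.
have := tame_cvg (n:=n) tB (fun n => cvg_neumann (n:=n) su).
under eq_fun do rewrite tame_series_iter//.
move=> h; apply: norm_cvg_unique h (cvg_neumann (n:=n) (tame_sqsum tB su)).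
Qed.

Lemma neumann_fix u : sqsum u ->
  neumann u = (fun n => u n + T (neumann u) n).
Proof.
(* Taking [B := T] turns [T (neumann u)] into [neumann (T u)], the tail of the series left after its
   first term [u]. *)
move=> su; rewrite neumann_comm//; apply/funext => n.
apply: norm_cvg_unique (cvg_neumann (n:=n) su) _.
suff : series (fun i => iter i T u n) @ \oo --> u n + neumann (T u) n by [].
rewrite -cvg_shiftS.
rewrite (_ : [sequence _]_k = (fun k => u n + series (fun i => iter i T (T u) n) k)).
  by apply: cvgD; [exact: cvg_cst|exact: cvg_neumann (tame_sqsum tT su)].
by apply/funext => k; rewrite /= series_iterS.
Qed.

Lemma neumann_lin a u v : sqsum u -> sqsum v ->
  neumann (fun n => a * u n + v n) = (fun n => a * neumann u n + neumann v n).
Proof.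
move=> su sv; apply/funext => n.
apply: norm_cvg_unique (cvg_neumann (n:=n) (sqsum_comb a su sv)) _.
rewrite (_ : series _ = (fun k => a * series (fun i => iter i T u n) k +
    series (fun i => iter i T v n) k)).
  apply: cvgD; last exact: cvg_neumann.
  by apply: cvgM; [exact: cvg_cst|exact: cvg_neumann].
apply/funext => k; rewrite !seriesEord/= mulr_sumr -big_split/=.
apply: eq_bigr => i _; suff -> : iter i T (fun n => a * u n + v n) =
  (fun n => a * iter i T u n + iter i T v n) by [].
by elim: (i : nat) => //= j ->; rewrite tame_lin.
Qed.

(* Minkowski's inequality is replaced by
   [|u + w|^2 <= (1 + 1/e) |u|^2 + (1 + e) |w|^2], which passes through the
   recursion [v_(k+1) = u + T v_k] as soon as [(1 + e) q <= 1 - e]. *)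
Lemma neumann_bdd : exists2 C, 0 <= C & forall u, sqsum u ->
  sqsum (neumann u) /\ dot (neumann u) (neumann u) <= C * dot u u.
Proof.
(* With this [e] the gap [(1 - e) - (1 + e) q] equals [(1 - q)^2 / 2], hence is nonnegative. *)
pose e := (1 - q) / 2; have e0 : 0 < e by rewrite divr_gt0 ?subr_gt0.
have eq1 : (1 + e) * q <= 1 - e by have := sqr_ge0 (1 - q); rewrite /e expr2; lra.
have ei : e * e^-1 = 1 by rewrite mulfV// gt_eqF.
have ei0 : 0 < e^-1 by rewrite invr_gt0.
(* [C] is the fixed point of the recursion on bounds: [C = (1 + e^-1) + (1 - e) C]. *)
pose C := (1 + e^-1) / e.
have C0 : 0 <= C by rewrite /C mulr_ge0// ?ltW//; lra.
have Ce : C * e = 1 + e^-1 by rewrite /C mulfVK// gt_eqF.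
exists C => // u su; apply: dot_fatou (fun n => cvg_neumann (n:=n) su) => k.
elim: k => [|k [sv lev]].
  rewrite (_ : (fun n => _) = (fun n => 0 * u n)); last first.
    by apply/funext => n; rewrite seriesEord/= big_ord0 mul0r.
  split; first exact: sqsumZ.
  by rewrite dotZl ?mul0r ?(mulr_ge0 C0) ?dot_ge0//; exact: sqsumZ.
set v := (fun n => _) in sv lev.
have -> : (fun n => series (fun i => iter i T u n) k.+1) = (fun n => 1 * u n + T v n).
  apply/funext => n; rewrite series_iterS mul1r /v tame_series_iter//.
have sT := tame_sqsum tT sv.
split; first exact: sqsum_comb.
rewrite dot_sqrD// expr1n !mul1r mulr1.
have h1 := dot_ge0 (sqsum_comb (- e) sT su).
rewrite dot_sqrD// dotC in h1.
have h2 := contr sv.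
(* Young's inequality, from [|u - e T v|^2 >= 0] divided by [e]. *)
have h3 : 2 * dot u (T v) <= e^-1 * dot u u + e * dot (T v) (T v).
  rewrite -(ler_pM2l e0) [leRHS]mulrDr (mulrA e e^-1) ei mul1r.
  by move: h1; rewrite sqrrN expr2; lra.
have h4 : (1 + e) * dot (T v) (T v) <= (1 - e) * (C * dot u u).
  apply: (@le_trans _ _ ((1 + e) * (q * dot v v))).
    by rewrite ler_wpM2l//; lra.
  rewrite mulrA; apply: ler_pM => //; [|exact: dot_ge0].
  by rewrite mulr_ge0//; lra.
have h5 : C * e * dot u u = (1 + e^-1) * dot u u by rewrite Ce.
lra.
Qed.

End Neumann.

(** * Real resolvent of a symmetric operator bounded below *)

Section Resolvent.
Context {R : realType} {I : choiceType}.
Variables (A : (I -> R) -> I -> R) (m x : R).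
Hypothesis tA : tame A.
Hypothesis symA : forall f g, sqsum f -> sqsum g -> dot (A f) g = dot f (A g).
Hypothesis lowA : forall f, sqsum f -> m ^+ 2 * dot f f <= dot (A f) (A f).
Hypothesis xm : - m < x < m.

Lemma real_resolvent : exists S : (I -> R) -> I -> R,
  [/\ forall a u v, sqsum u -> sqsum v ->
        S (fun n => a * u n + v n) = (fun n => a * S u n + S v n),
      exists2 M, 0 <= M & forall u, sqsum u ->
        sqsum (S u) /\ dot (S u) (S u) <= M * dot u u &
      forall u, sqsum u ->
        S (fun n => A u n - x * u n) = u /\
        (fun n => A (S u) n - x * S u n) = u].
Proof.
(* [Ap y] stands for [A + y], so [P] below is [(A + x)(A - x)]; [PE'] gives the factors in the other
   order. *)
pose Ap y f n : R := y * f n + A f n.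
have tAp y : tame (Ap y) by apply: tame_comb => //; exact: tame_id.
pose P := Ap x \o Ap (- x).
have tP : tame P by exact: tame_comp.
have PE f : P f = (fun n => A (A f) n - x ^+ 2 * f n).
  by rewrite /P /= /Ap tame_lin//; apply/funext => n; ring.
have PE' f : Ap (- x) (Ap x f) = P f.
  by rewrite PE /Ap tame_lin//; apply/funext => n; ring.
have [M M0 PM] := tame_bdd tP.
pose c := m ^+ 2 - x ^+ 2; have c0 : 0 < c.
  by have /andP[xl xr] := xm; rewrite /c subr_sqr mulr_gt0 ?subr_gt0// -ltrBlDl sub0r.
(* The summand [c] ensures [c <= K], hence [0 <= q]; the summand [M / c] ensures [M <= c K], used
   for the contraction. *)
pose K := M / c + c.
have Kc : c <= K by rewrite /K lerDr divr_ge0// ltW.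
have K0 : 0 < K by exact: lt_le_trans Kc.
have KM : M <= c * K by rewrite /K mulrDr mulrCA mulfV ?gt_eqF// mulr1 lerDl mulr_ge0// ltW.
have Ki0 : 0 < K^-1 by rewrite invr_gt0.
have KiK : K^-1 * K = 1 by rewrite mulVf// gt_eqF.
pose T f n := - K^-1 * P f n + f n.
have tT : tame T by apply: tame_comb => //; exact: tame_id.
pose q := 1 - K^-1 * c.
have q0 : 0 <= q by rewrite subr_ge0 ler_pdivrMl// mulr1.
have q1 : q < 1 by rewrite ltrBlDr ltrDl mulr_gt0.
(* In [|f - P f / K|^2] the cross term is at most [- 2 (c / K) |f|^2], while
   [|P f|^2 / K^2 <= (c / K) |f|^2] because [M <= c K]. Together they leave the factor
   [1 - c / K]. *)
have contr f : sqsum f -> dot (T f) (T f) <= q * dot f f.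
  move=> sf; have [sP leP] := PM _ sf; have sAf := tame_sqsum tA sf.
  have sAAf := tame_sqsum tA sAf.
  have lowP : c * dot f f <= dot (P f) f.
    rewrite PE (_ : (fun n => _) = (fun n => - x ^+ 2 * f n + A (A f) n)).
      by rewrite dot_combl// symA// /c; have := lowA sf; lra.
    by apply/funext => n; ring.
  rewrite /T dot_sqrD// sqrrN /q.
  have h1 : K^-1 * (K^-1 * dot (P f) (P f)) <= K^-1 * (c * dot f f).
    rewrite ler_pM2l// ler_pdivrMl// mulrA [K * c]mulrC.
    by apply: le_trans leP _; rewrite ler_wpM2r// dot_ge0.
  have h2 : K^-1 * (c * dot f f) <= K^-1 * dot (P f) f by rewrite ler_pM2l.
  rewrite expr2; lra.
pose G := neumann T.
(* The fixed-point equation [G u = u + G u - P (G u) / K] says that [G] inverts [P / K]. *)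
have PG u : sqsum u -> P (G u) = (fun n => K * u n).
  move=> su; have := neumann_fix tT q0 q1 contr su => e; apply/funext => n.
  move: (congr1 (fun f => f n) e); rewrite -/G /T => h.
  have : K^-1 * P (G u) n = u n by lra.
  by move=> <-; rewrite mulrA mulfV ?gt_eqF// mul1r.
(* [T] is a polynomial in [A], so it commutes with [A + x] and [A - x]. For [A - x] this passes to
   [G], which is what the left inverse requires. *)
have comm y : (y == x) || (y == - x) -> forall f, Ap y (T f) = T (Ap y f).
  move=> yx f; rewrite /T tame_lin//.
  suff -> : Ap y (P f) = P (Ap y f) by [].
  by case/orP : yx => /eqP ->; rewrite /P /= ?PE' // -/(P _) -PE'.
have GA u : sqsum u -> G (Ap (- x) u) = Ap (- x) (G u).
  by move=> su; rewrite /G -(neumann_comm tT q0 q1 contr)//; apply: comm; rewrite eqxx orbT.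
have [N N0 GN] := neumann_bdd tT q0 q1 contr.
exists (fun u n => K^-1 * Ap x (G u) n); split=> [a u v su sv||u su].
- rewrite /G (neumann_lin tT q0 q1 contr)// tame_lin//; apply/funext => n; ring.
(* Adding the zero operator puts [K^-1 * Ap x] into the shape of [tame_comb]. *)
- have [M' M'0 M'P] := tame_bdd (tame_comb K^-1 (tAp x) (@tame_zero R I)).
  exists (M' * N) => [|u su]; first exact: mulr_ge0.
  have [sG leG] := GN _ su; have [] := M'P _ sG.
  under eq_fun do rewrite addr0; move=> sS leS; split=> //.
  by rewrite (le_trans leS)// -mulrA ler_wpM2l.
- have e f n : A f n - x * f n = Ap (- x) f n by rewrite /Ap; ring.
  split.
    under [X in G X]eq_fun do rewrite e; rewrite GA//.
    have := PG _ su; rewrite /P /= => ->.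
    by apply/funext => n; rewrite mulrA KiK mul1r.
  under eq_fun do rewrite e; rewrite tameZ// PE' PG//.
  by apply/funext => n; rewrite mulrA KiK mul1r.
Qed.

End Resolvent.

(** * Transfer from real-valued to complex-valued functions *)

Section Complexification.
Context {R : realType} {T : choiceType}.
Implicit Types (u v : T -> R[i]) (x : R).

Lemma l2_sqr_normE u : l2_sqr_norm u =
  (\esum_(n in [set: T]) ((complex.Re (u n)) ^+ 2)%:E +
   \esum_(n in [set: T]) ((complex.Im (u n)) ^+ 2)%:E)%E.
Proof.
rewrite -esumD; [|by move=> n _; rewrite lee_fin sqr_ge0..].
apply: eq_esum => n _; rewrite -EFinD; congr EFin.
by case: (u n) => a b /=; rewrite sqr_sqrtr// addr_ge0// sqr_ge0.
Qed.

Lemma l2P u : l2 u <->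
  sqsum (fun n => complex.Re (u n)) /\ sqsum (fun n => complex.Im (u n)).
Proof.
rewrite /l2 /= l2_sqr_normE /sqsum !summ_ge0E; [|by move=> n; exact: sqr_ge0..].
split; last by case=> ? ?; exact: lte_add_pinfty.
move=> h; split; apply: le_lt_trans h; [rewrite leeDl//|rewrite leeDr//];
  by apply: esum_ge0 => n _; rewrite lee_fin sqr_ge0.
Qed.

Lemma l2_normE u : l2 u -> l2_norm u =
  Num.sqrt (dot (fun n => complex.Re (u n)) (fun n => complex.Re (u n)) +
            dot (fun n => complex.Im (u n)) (fun n => complex.Im (u n))).
Proof.
move=> /l2P[sr si]; rewrite /l2_norm l2_sqr_normE fineD; last 2 first.
- by apply: esum_fin => // n; exact: sqr_ge0.
- by apply: esum_fin => // n; exact: sqr_ge0.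
by rewrite -!rsum_ge0E//; move=> n; exact: sqr_ge0.
Qed.

(** The complex inverse applies [S] to real and imaginary parts separately. An operator that acts on
    the two parts by the same real [B] is inverted part by part. *)
Lemma resolvent_set_real (A : (T -> R[i]) -> T -> R[i]) (B S : (T -> R) -> T -> R) x :
  (forall u n, complex.Re (A u n) = B (fun k => complex.Re (u k)) n) ->
  (forall u n, complex.Im (A u n) = B (fun k => complex.Im (u k)) n) ->
  (forall a f g, sqsum f -> sqsum g ->
     S (fun n => a * f n + g n) = (fun n => a * S f n + S g n)) ->
  (exists2 M, 0 <= M & forall f, sqsum f ->
     sqsum (S f) /\ dot (S f) (S f) <= M * dot f f) ->
  (forall f, sqsum f -> S (fun n => B f n - x * f n) = f /\
     (fun n => B (S f) n - x * S f n) = f) ->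
  resolvent_set A x%:C.
Proof.
move=> ReA ImA linS [M M0 bddS] invS.
exists (fun u n => S (fun k => complex.Re (u k)) n +i* S (fun k => complex.Im (u k)) n).
have l2S u : l2 u -> l2 (fun n => S (fun k => complex.Re (u k)) n +i*
    S (fun k => complex.Im (u k)) n).
  by move=> /l2P[sr si]; apply/l2P; split; [case: (bddS _ sr)|case: (bddS _ si)].
split; first split=> //.
- move=> z u v /l2P[ur ui] /l2P[vr vi]; apply/funext => n.
  case: z => a b.
  (* Multiplication by [a + i b] mixes the two parts with real coefficients, so two uses of real
     linearity give complex linearity. *)
  rewrite (_ : (fun k => complex.Re _) = (fun k => a * complex.Re (u k) +
      (- b * complex.Im (u k) + complex.Re (v k)))); last first.
    by apply/funext => k; case: (u k) (v k) => [? ?] [? ?] /=; ring.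
  rewrite (_ : (fun k => complex.Im _) = (fun k => a * complex.Im (u k) +
      (b * complex.Re (u k) + complex.Im (v k)))); last first.
    by apply/funext => k; case: (u k) (v k) => [? ?] [? ?] /=; ring.
  rewrite !linS//; [|exact: sqsum_comb..].
  by apply/eqP; rewrite eq_complex/=; apply/andP; split; apply/eqP; ring.
(* [M] bounds squared norms, whereas [l2_norm] is the norm itself. *)
- exists (Num.sqrt M) => u lu; have /l2P[sr si] := lu.
  rewrite !l2_normE//; last exact: l2S.
  rewrite -sqrtrM// ler_wsqrtr//= mulrDr lerD//.
    by case: (bddS _ sr).
  by case: (bddS _ si).
move=> u /l2P[sr si]; have [r1 r2] := invS _ sr; have [i1 i2] := invS _ si.
have ReB w n : complex.Re (A w n - x%:C * w n) =
    B (fun k => complex.Re (w k)) n - x * complex.Re (w n).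
  by rewrite -ReA; case: (A w n) (w n) => [? ?] [? ?] /=; ring.
have ImB w n : complex.Im (A w n - x%:C * w n) =
    B (fun k => complex.Im (w k)) n - x * complex.Im (w n).
  by rewrite -ImA; case: (A w n) (w n) => [? ?] [? ?] /=; ring.
split; apply/funext => n.
  under [X in S X]eq_fun do rewrite ReB.
  under [X in _ +i* S X _]eq_fun do rewrite ImB.
  by rewrite r1 i1; case: (u n).
apply/eqP; rewrite eq_complex ReB ImB /=; apply/andP; split; apply/eqP.
  exact: (congr1 (fun f => f n) r2).
exact: (congr1 (fun f => f n) i2).
Qed.

End Complexification.

(** * The Laplacian, the checkerboard potential and their anticommutation *)

Section Checkerboard.
Context {R : realType} {d : nat}.
Implicit Types (f g h : 'rV[int]_d -> R) (c n : 'rV[int]_d).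

Definition real_laplacian f n : R :=
  \sum_(j < d) (f (n - delta_mx 0 j) + f (n + delta_mx 0 j)).

Lemma set_bij_addr c : set_bij setT setT (fun n => n + c).
Proof.
split=> // [n m _ _|n _]; first exact: addIr.
by exists (n - c) => //; rewrite subrK.
Qed.

Lemma tame_translate c : tame (fun f n => f (n + c)).
Proof. exact/tame_reindex/set_bij_addr. Qed.

Lemma tame_real_laplacian : tame real_laplacian.
Proof.
apply: tame_sum => j.
have := tame_comb 1 (tame_translate (- delta_mx 0 j)) (tame_translate (delta_mx 0 j)).
by under eq_fun do under eq_fun do rewrite mul1r.
Qed.

Lemma dot_translate c f g : dot (fun n => f (n + c)) g = dot f (fun n => g (n - c)).
Proof.
rewrite /dot -[RHS](rsum_bij _ (set_bij_addr c)).
by congr rsum; apply/funext => n /=; rewrite addrK.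
Qed.

(** The adjoint of a translation is the opposite translation, so each pair of hops along a basis
    vector is symmetric. *)
Lemma real_laplacian_sym f g : sqsum f -> sqsum g ->
  dot (real_laplacian f) g = dot f (real_laplacian g).
Proof.
move=> sf sg; pose L (j : 'I_d) h n := 1 * h (n - delta_mx 0 j) + h (n + delta_mx 0 j).
have tL j : tame (L j) := tame_comb 1 (tame_translate _) (tame_translate _).
have LE h : real_laplacian h = (fun n => \sum_j L j h n).
  by apply/funext => n; apply: eq_bigr => j _; rewrite /L mul1r.
have st h c : sqsum h -> sqsum (fun n => h (n + c)).
  by move=> sh; exact: (tame_sqsum (tame_translate c) sh).
have sL h j : sqsum h -> sqsum (L j h) by move=> sh; exact: (tame_sqsum (tL j) sh).
rewrite !LE dot_suml//; last by move=> j; exact: sL.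
rewrite dotC dot_suml//; last by move=> j; exact: sL.
apply: eq_bigr => j _; rewrite (dotC _ f) /L.
rewrite dot_combl ?dot_combr//; [|exact: st..].
by rewrite !dot_translate opprK; ring.
Qed.

Variable delta : R.
Let V := @checkerboard R d delta.

(** One hop adds 1 to the coordinate sum and thus flips its parity. *)
Lemma checkerboard_shift n (j : 'I_d) : V (n + delta_mx 0 j) = - V n.
Proof.
rewrite /V /checkerboard (_ : \sum_(k < d) _ = (\sum_(k < d) n 0 k) + 1).
  set s := \sum_(k < d) _.
  have -> : (2 %| s + 1)%Z = ~~ (2 %| s)%Z by lia.
  by case: (2 %| s)%Z => /=; rewrite ?opprK.
under eq_bigr do rewrite mxE; rewrite big_split/=; congr (_ + _).
rewrite (bigD1 j)//= mxE !eqxx big1 ?addr0// => k kj.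
by rewrite mxE (negbTE kj) andbF.
Qed.

Lemma checkerboard_shiftN n (j : 'I_d) : V (n - delta_mx 0 j) = - V n.
Proof. by rewrite -{2}(subrK (delta_mx 0 j) n) checkerboard_shift opprK. Qed.

Lemma checkerboard_sqr n : V n * V n = delta ^+ 2.
Proof. by rewrite /V /checkerboard; case: ifP => _; rewrite ?mulrNN expr2. Qed.

Lemma tame_checkerboard : tame (fun f n => V n * f n).
Proof.
apply: (@tame_mul _ _ _ `|delta|) => n.
by rewrite /V /checkerboard; case: ifP; rewrite ?normrN.
Qed.

Lemma real_laplacian_checkerboard f :
  real_laplacian (fun n => V n * f n) = (fun n => -1 * (V n * real_laplacian f n)).
Proof.
apply/funext => n; rewrite /real_laplacian !mulr_sumr; apply: eq_bigr => j _.
rewrite checkerboard_shift checkerboard_shiftN; ring.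
Qed.

(** By symmetry and anticommutation [<L f, V f> = <f, L V f> = - <f, V L f> = - <L f, V f>], so this
    number is its own opposite. *)
Lemma dot_laplacian_checkerboard f : sqsum f ->
  dot (real_laplacian f) (fun n => V n * f n) = 0.
Proof.
move=> sf; have sV := tame_sqsum tame_checkerboard sf.
have sL := tame_sqsum tame_real_laplacian sf.
have: dot (real_laplacian f) (fun n => V n * f n) =
    - dot (real_laplacian f) (fun n => V n * f n); last by lra.
rewrite {1}real_laplacian_sym// real_laplacian_checkerboard dotC dotZl//; last first.
  exact: (tame_sqsum tame_checkerboard sL).
rewrite mulN1r; congr (- rsum _); apply/funext => n; ring.
Qed.

(* The factor [1] matches the shape [a * f + g] of [tame_comb] and [dot_sqrD]. *)
Definition real_schrodinger f n : R := 1 * real_laplacian f n + V n * f n.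

Lemma tame_real_schrodinger : tame real_schrodinger.
Proof. exact: tame_comb tame_real_laplacian tame_checkerboard. Qed.

Lemma real_schrodinger_sym f g : sqsum f -> sqsum g ->
  dot (real_schrodinger f) g = dot f (real_schrodinger g).
Proof.
move=> sf sg.
have sV h : sqsum h -> sqsum (fun n => V n * h n).
  by move=> sh; exact: (tame_sqsum tame_checkerboard sh).
have sL h : sqsum h -> sqsum (real_laplacian h).
  by move=> sh; exact: (tame_sqsum tame_real_laplacian sh).
rewrite /real_schrodinger dot_combl ?dot_combr//; [|exact: sL|exact: sV|exact: sL|exact: sV].
rewrite real_laplacian_sym//; congr (_ + rsum _); apply/funext => n; ring.
Qed.

(** The cross term of [|L f + V f|^2] vanishes and [V^2] is the constant [delta^2]; dropping
    [|L f|^2 >= 0] leaves the bound. *)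
Lemma real_schrodinger_lower f : sqsum f ->
  delta ^+ 2 * dot f f <= dot (real_schrodinger f) (real_schrodinger f).
Proof.
move=> sf; have sV := tame_sqsum tame_checkerboard sf.
have sL := tame_sqsum tame_real_laplacian sf.
rewrite dot_sqrD// dot_laplacian_checkerboard// mulr0 addr0 expr1n mul1r.
rewrite -dotZl// (_ : dot _ f = dot (fun n => V n * f n) (fun n => V n * f n)).
  by rewrite lerDr dot_ge0.
by congr rsum; apply/funext => n; rewrite -(checkerboard_sqr n); ring.
Qed.

Lemma Re_schrodinger (u : 'rV[int]_d -> R[i]) n :
  complex.Re (schrodinger V u n) = real_schrodinger (fun k => complex.Re (u k)) n.
Proof.
rewrite /schrodinger raddfD /real_schrodinger mul1r; congr (_ + _).
  by rewrite raddf_sum; apply: eq_bigr => j _; rewrite raddfD.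
by case: (u n) => a b /=; ring.
Qed.

Lemma Im_schrodinger (u : 'rV[int]_d -> R[i]) n :
  complex.Im (schrodinger V u n) = real_schrodinger (fun k => complex.Im (u k)) n.
Proof.
rewrite /schrodinger raddfD /real_schrodinger mul1r; congr (_ + _).
  by rewrite raddf_sum; apply: eq_bigr => j _; rewrite raddfD.
by case: (u n) => a b /=; ring.
Qed.

End Checkerboard.

(** * The spectral gap *)

Theorem theorem6p3 (R : realType) (d : nat) (delta : R) (hd : (1 <= d)%N)
    (hdelta : 0 < delta) :
  spectrum (schrodinger (@checkerboard R d delta))
    `&` [set x%:C | x in [set x : R | - delta < x < delta]] = set0.
Proof.
apply/seteqP; split=> // z [spec [x xdelta xz]]; apply: spec; rewrite -xz.
(* The lower bound on the Schrodinger operator makes [delta] the [m] of the abstract result. *)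
have [S [linS bddS invS]] := real_resolvent (@tame_real_schrodinger R d delta)
  (real_schrodinger_sym delta) (real_schrodinger_lower delta) xdelta.
exact: (resolvent_set_real (Re_schrodinger delta) (Im_schrodinger delta) linS bddS invS).
Qed.
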